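(* Let $p\ge2$ be an integer, $q=e^{i\pi/p}$ (with $i$ here the imaginary unit), and let $1\le i\le p-1$ be an integer. Let $\Gamma: X^{\otimes(i-1)}\to\mathcal{X}^+_i\to\mathcal{P}^+_i\to X^{\otimes(2p-i-1)}$ be the composite $\bar U_q(\mathfrak{sl}_2)$-homomorphism described in the context. Then, up to a nonzero constant, $\Gamma$ is given diagrammatically by $$(f_{p-1}\otimes 1^{\otimes(p-i)})\,(1^{\otimes(i-1)}\otimes\cap^{(p-i)}):X^{\otimes(i-1)}\to X^{\otimes(2p-i-1)},$$ i.e. this operator equals a nonzero scalar multiple of $\Gamma$.
   Context: $\bar U_q(\mathfrak{sl}_2)$ is the Hopf algebra over a field $\mathbb{K}$ (containing $q$, e.g. $\mathbb{C}$) generated by $E,F,K$ with $KEK^{-1}=q^2E$, $KFK^{-1}=q^{-2}F$, $EF-FE=\frac{K-K^{-1}}{q-q^{-1}}$, $E^p=F^p=0$, $K^{2p}=1$, $\Delta E=E\otimes K+1\otimes E$, $\Delta F=F\otimes 1+K^{-1}\otimes F$, $\Delta K=K\otimes K$. Put $[n]=\frac{q^n-q^{-n}}{q-q^{-1}}$, $[n]!=[1]\cdots[n]$. $X=\mathcal{X}^+_2$ has basis $\nu_0,\nu_1$ with $K\nu_0=q\nu_0$, $K\nu_1=q^{-1}\nu_1$, $E\nu_0=0$, $E\nu_1=\nu_0$, $F\nu_0=\nu_1$, $F\nu_1=0$. For $1\le i_1<\dots<i_n\le z$, $\rho_{i_1,\dots,i_n,z}\in X^{\otimes z}$ is the basis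 tensor with $\nu_1$ in positions $i_1,\dots,i_n$ and $\nu_0$ elsewhere; $x_{0,z}=\nu_0^{\otimes z}$. $\mathcal{X}^+_i$ is the simple module with basis $z_0,\dots,z_{i-1}$ and $Kz_k=q^{i-1-2k}z_k$, $Ez_k=[k][i-k]z_{k-1}$, $Fz_k=z_{k+1}$ ($z_{-1}=z_i=0$). $\mathcal{P}^+_i$ is the $2p$-dimensional indecomposable projective module with basis $\{a_k,b_k\}_{0\le k\le i-1}\cup\{x_j,y_j\}_{0\le j\le p-i-1}$ and action $Ka_k=q^{i-1-2k}a_k$, $Kb_k=q^{i-1-2k}b_k$, $Kx_j=-q^{p-i-1-2j}x_j$, $Ky_j=-q^{p-i-1-2j}y_j$; $Ea_k=[k][i-k]a_{k-1}$, $Eb_k=[k][i-k]b_{k-1}+a_{k-1}$ ($k\ge1$), $Eb_0=x_{p-i-1}$, $Ex_j=-[j][p-i-j]x_{j-1}$, $Ey_j=-[j][p-i-j]y_{j-1}$ ($j\ge1$), $Ey_0=a_{i-1}$; $Fa_k=a_{k+1}$, $Fb_k=b_{k+1}$ ($k<i-1$), $Fb_{i-1}=y_0$, $Fx_j=x_{j+1}$ ($j<p-i-1$), $Fx_{p-i-1}=a_0$, $Fy_j=y_{j+1}$, with $x_{-1}=a_{-1}=a_i=y_{p-i}=0$. The three maps composing $\Gamma$: (i) $X^{\otimes(i-1)}\to\mathcal{X}^+_i$: for $0\le n\le i-1$, $\rho_{i_1,\dots,i_n,i-1}\mapsto q^{\,n(i-1)-\frac12(n^2-n)-\sum_{j=1}^n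 i_j}\,\frac{[i-1-n]!}{[i-1]!}\,z_n$; (ii) $\mathcal{X}^+_i\to\mathcal{P}^+_i$: $z_n\mapsto a_n$; (iii) $\mathcal{P}^+_i\to X^{\otimes(2p-i-1)}$: the inclusion of the summand, for which $a_n\mapsto F^{n+p-i}x_{0,2p-i-1}$ (only these values matter for $\Gamma$). Diagrams act as follows (composition right to left, $1$ is the identity strand): $\cup:X\otimes X\to\mathbb{K}$, $\cup(\nu_0\otimes\nu_0)=\cup(\nu_1\otimes\nu_1)=0$, $\cup(\nu_0\otimes\nu_1)=-q$, $\cup(\nu_1\otimes\nu_0)=1$; $\cap:\mathbb{K}\to X\otimes X$, $\cap(1)=q^{-1}\nu_1\otimes\nu_0-\nu_0\otimes\nu_1$. $\cap^{(m)}:\mathbb{K}\to X^{\otimes2m}$ is the nested $m$-fold cap, pairing position $k$ with position $2m+1-k$. $f_n$ is the Jones–Wenzl projection on $X^{\otimes n}$ (for $n\le p-1$): $f_1=1$, $f_n=f_{n-1}\otimes1-\frac{[n-1]}{[n]}(f_{n-1}\otimes1)\mathbf{e}_{n-1}(f_{n-1}\otimes1)$, where $\mathbf{e}_k=1^{\otimes(k-1)}\otimes\cap\cup\otimes1^{\otimes(n-k-1)}$. *)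

(* Defs.v *)
From HB Require Import structures.
From mathcomp Require Import all_boot all_order all_algebra.
From mathcomp Require Import zify complex.
From mathcomp Require Import reals trigo.

Set Implicit Arguments.
Unset Strict Implicit.
Unset Printing Implicit Defensive.

Import Order.TTheory GRing.Theory Num.Theory.
Local Open Scope ring_scope.

(* q is the complex number e^(i pi / p), seen as an element of K through a
   field L shared by K and the complex numbers.  L = K = R[i] with identity
   embeddings gives the literal complex number; a subfield of R[i] containing
   it and an extension of R[i] are covered as well. *)
Definition is_exp_ipi_over (R : realType) (K : fieldType) (p : nat) (q : K)
    : Prop :=
  exists (L : fieldType) (toC : {rmorphism L -> R[i]})
         (toK : {rmorphism L -> K}) (z : L),
    toC z = (cos (pi / p%:R) +i* sin (pi / p%:R))%C /\ toK z = q.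

Section FreeModule.
Variable K : fieldType.

(* The vector space with basis I, its basis vectors, and the linear map with
   prescribed values on the basis. *)
Definition freemod (I : finType) := {ffun I -> K^o}.

Definition ket (I : finType) (i : I) : freemod I := [ffun j => (j == i)%:R].

Definition lext (I : finType) (V : vectType K) (g : I -> V) :
    'Hom(freemod I, V) :=
  linfun (fun v : freemod I => \sum_i (v i : K) *: g i).

Lemma lext_ket (I : finType) (V : vectType K) (g : I -> V) (i : I) :
  lext g (ket i) = g i.
Proof.
pose h (v : freemod I) := \sum_j (v j : K) *: g j.
have hl : linear h.
  move=> a u v; rewrite /h scaler_sumr -big_split /=; apply: eq_bigr => j _.
  by rewrite !ffunE scalerDl scalerA.
pose hL : {linear _ -> _} := HB.pack h (GRing.isLinear.Build _ _ _ _ h hl).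
rewrite /lext -[linfun _]/(linfun hL) lfunE /= /h (bigD1 i) //= big1 => [|j ji].
  by rewrite addr0 ffunE eqxx scale1r.
by rewrite ffunE (negPf ji) scale0r.
Qed.

(* The basis vector of index k, and 0 when k is out of range. *)
Definition oket (n k : nat) : freemod 'I_n :=
  if insub k is Some o then ket o else 0.

(* The n-th tensor power of X: the word w stands for the basis tensor with
   nu_1 in the positions where w is true and nu_0 elsewhere.  In particular
   tpow 0 is the ground field, with basis the empty word. *)
Definition tpow (n : nat) := freemod (n.-tuple bool).

Definition word_l m n (w : (m + n).-tuple bool) : m.-tuple bool :=
  [tuple tnth w (lshift n j) | j < m].
Definition word_r m n (w : (m + n).-tuple bool) : n.-tuple bool :=
  [tuple tnth w (rshift m j) | j < n].

Definition tensv m n (u : tpow m) (v : tpow n) : tpow (m + n) :=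
  [ffun w => (u (word_l w) : K) * (v (word_r w) : K)].

Definition tens m m' n n' (f : 'Hom(tpow m, tpow m'))
    (g : 'Hom(tpow n, tpow n')) : 'Hom(tpow (m + n), tpow (m' + n')) :=
  lext (fun w => tensv (f (ket (word_l w))) (g (ket (word_r w)))).

Definition strands n : 'End(tpow n) := \1%VF.

Definition casth m m' n n' (em : m = m') (en : n = n')
    (f : 'Hom(tpow m, tpow n)) : 'Hom(tpow m', tpow n') :=
  let: erefl in _ = m1 := em return 'Hom(tpow m1, tpow n') in
  let: erefl in _ = n1 := en return 'Hom(tpow m, tpow n1) in f.

End FreeModule.

Section QuantumGroup.
Variables (K : fieldType) (q : K).

Definition qint (n : nat) : K := (q ^+ n - q ^- n) / (q - q^-1).
Definition qfact (n : nat) : K := \prod_(1 <= k < n.+1) qint k.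

(* The operators by which the generators E, F, K of the restricted quantum
   group act on V.  K^-1 acts by the inverse of uqK, so that a linear map is a
   homomorphism as soon as it commutes with these three operators. *)
Record uq_action (V : vectType K) := UqAction {
  uqE : 'End(V); uqF : 'End(V); uqK : 'End(V) }.

Definition uq_hom (V W : vectType K) (aV : uq_action V) (aW : uq_action W)
    (f : 'Hom(V, W)) : Prop :=
  [/\ (f \o uqE aV = uqE aW \o f)%VF,
      (f \o uqF aV = uqF aW \o f)%VF &
      (f \o uqK aV = uqK aW \o f)%VF].

Definition summand_inclusion (V W : vectType K) (aV : uq_action V)
    (aW : uq_action W) (f : 'Hom(V, W)) : Prop :=
  uq_hom aV aW f /\
  exists2 r : 'Hom(W, V), uq_hom aW aV r & (r \o f = \1)%VF.

Definition nu0 : tpow K 1 := ket K [tuple false].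
Definition nu1 : tpow K 1 := ket K [tuple true].

Definition X_action : uq_action (tpow K 1) := UqAction
  (lext (fun w : 1.-tuple bool => if thead w then nu0 else 0))
  (lext (fun w : 1.-tuple bool => if thead w then 0 else nu1))
  (lext (fun w : 1.-tuple bool => if thead w then q^-1 *: nu1 else q *: nu0)).

(* Action through the coproduct Delta. *)
Definition tens_action m n (a : uq_action (tpow K m))
    (b : uq_action (tpow K n)) : uq_action (tpow K (m + n)) := UqAction
  (tens (uqE a) (uqK b) + tens (strands K m) (uqE b))
  (tens (uqF a) (strands K n) + tens ((uqK a)^-1)%VF (uqF b))
  (tens (uqK a) (uqK b)).

(* On the ground field tpow 0 the action is given by the counit. *)
Fixpoint tpow_action (n : nat) : uq_action (tpow K n) :=
  if n is m.+1 then tens_action X_action (tpow_action m)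
  else UqAction 0 0 \1%VF.

(* The simple module with basis z_0, .., z_(i-1).  At k = 0 the value of E is
   zero because qint 0 = 0; the same device is used in Pproj_E. *)
Definition Xsimple (i : nat) := freemod K 'I_i.

Definition Xsimple_action (i : nat) : uq_action (Xsimple i) := UqAction
  (lext (fun k : 'I_i => (qint k * qint (i - k)) *: oket K i k.-1))
  (lext (fun k : 'I_i => oket K i k.+1))
  (lext (fun k : 'I_i => (q ^ (i%:Z - 1 - 2 * k%:Z)) *: ket K k)).

(* The projective module with basis a_k, b_k (k < i), x_j, y_j (j < p - i). *)
Definition Pbasis (p i : nat) : finType :=
  (('I_i + 'I_i) + ('I_(p - i) + 'I_(p - i)))%type.

Definition Pproj (p i : nat) := freemod K (Pbasis p i).

Section Projective.
Variables p i : nat.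

(* pa, pb, px, py are zero for an index out of range. *)
Definition pa (k : nat) : Pproj p i :=
  if insub k is Some o then ket K (inl (inl o) : Pbasis p i) else 0.
Definition pb (k : nat) : Pproj p i :=
  if insub k is Some o then ket K (inl (inr o) : Pbasis p i) else 0.
Definition px (j : nat) : Pproj p i :=
  if insub j is Some o then ket K (inr (inl o) : Pbasis p i) else 0.
Definition py (j : nat) : Pproj p i :=
  if insub j is Some o then ket K (inr (inr o) : Pbasis p i) else 0.

Definition Pproj_E (u : Pbasis p i) : Pproj p i :=
  match u with
  | inl (inl k) => (qint k * qint (i - k)) *: pa k.-1
  | inl (inr k) =>
      if k == 0 :> nat then px (p - i - 1)
      else (qint k * qint (i - k)) *: pb k.-1 + pa k.-1
  | inr (inl j) => - (qint j * qint (p - i - j)) *: px j.-1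
  | inr (inr j) =>
      if j == 0 :> nat then pa i.-1
      else - (qint j * qint (p - i - j)) *: py j.-1
  end.

Definition Pproj_F (u : Pbasis p i) : Pproj p i :=
  match u with
  | inl (inl k) => pa k.+1
  | inl (inr k) => if k == i.-1 :> nat then py 0 else pb k.+1
  | inr (inl j) => if j == (p - i - 1)%N :> nat then pa 0 else px j.+1
  | inr (inr j) => py j.+1
  end.

Definition Pproj_K (u : Pbasis p i) : Pproj p i :=
  match u with
  | inl (inl k) => q ^ (i%:Z - 1 - 2 * k%:Z) *: pa k
  | inl (inr k) => q ^ (i%:Z - 1 - 2 * k%:Z) *: pb k
  | inr (inl j) => - q ^ (p%:Z - i%:Z - 1 - 2 * j%:Z) *: px j
  | inr (inr j) => - q ^ (p%:Z - i%:Z - 1 - 2 * j%:Z) *: py j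
  end.

Definition Pproj_action : uq_action (Pproj p i) :=
  UqAction (lext Pproj_E) (lext Pproj_F) (lext Pproj_K).

End Projective.

(* The three maps composing Gamma.  A word w has n = count id w letters nu_1,
   in the (1-based) positions i_1 < .. < i_n. *)
Definition Gamma1 (i : nat) : 'Hom(tpow K i.-1, Xsimple i) :=
  lext (fun w : i.-1.-tuple bool =>
    let n := count id w in
    (q ^ ((n * i.-1)%N%:Z - ((n ^ 2 - n)./2)%N%:Z
          - (\sum_(j < i.-1 | tnth w j) j.+1)%N%:Z)
     * (qfact (i.-1 - n) / qfact i.-1)) *: oket K i n).

Definition Gamma2 (p i : nat) : 'Hom(Xsimple i, Pproj p i) :=
  lext (fun n : 'I_i => pa p i n).

Definition x0 (z : nat) : tpow K z := ket K [tuple of nseq z false].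

Definition is_Gamma3 (p i : nat)
    (f : 'Hom(Pproj p i, tpow K (2 * p - i - 1))) : Prop :=
  summand_inclusion (Pproj_action p i) (tpow_action (2 * p - i - 1)) f /\
  forall n : 'I_i,
    f (pa p i n) = iter (n + (p - i))
                     (uqF (tpow_action (2 * p - i - 1)))
                     (x0 (2 * p - i - 1)).

Definition cup : 'Hom(tpow K 2, tpow K 0) :=
  lext (fun w : 2.-tuple bool =>
    match val w with
    | [:: false; true] => - q *: ket K [tuple]
    | [:: true; false] => ket K [tuple]
    | _ => 0
    end).

Definition cap : 'Hom(tpow K 0, tpow K 2) :=
  lext (fun _ : 0.-tuple bool =>
    q^-1 *: ket K [tuple true; false] - ket K [tuple false; true]).

Fact ncap_eq m : (1 + (m + m) + 1 = m.+1 + m.+1)%N.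
Proof. by rewrite addn1 add1n addSn addnS. Qed.

(* An outer cap around m nested ones; (1 + 0) + 1 is convertible to 2. *)
Fixpoint ncap (m : nat) : 'Hom(tpow K 0, tpow K (m + m)) :=
  if m is k.+1 then
    casth (erefl 0%N) (ncap_eq k)
      (tens (tens (strands K 1) (ncap k)) (strands K 1) \o cap)%VF
  else strands K 0.

(* e_(n+1) on n + 2 strands. *)
Definition TL_last (n : nat) : 'End(tpow K n.+2) :=
  casth (addn2 n) (addn2 n) (tens (strands K n) (cap \o cup)%VF).

Definition add_strand n (f : 'End(tpow K n)) : 'End(tpow K n.+1) :=
  casth (addn1 n) (addn1 n) (tens f (strands K 1)).

Fixpoint JW (n : nat) : 'End(tpow K n) :=
  if n is m.+1 then
    (if m is k.+1 as m return 'End(tpow K m) -> 'End(tpow K m.+1) then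
       fun f => let g := add_strand f in
         g - (qint k.+1 / qint k.+2) *: (g \o TL_last k \o g)%VF
     else fun=> strands K 1) (JW m)
  else strands K 0.

Fact dim_JW p i : (0 < i < p)%N -> (p.-1 + (p - i) = 2 * p - i - 1)%N.
Proof. by move=> ?; lia. Qed.

Fact dim_ncap p i : (0 < i < p)%N ->
  (i.-1 + ((p - i) + (p - i)) = 2 * p - i - 1)%N.
Proof. by move=> ?; lia. Qed.

(* (f_(p-1) (x) 1^(p-i)) o (1^(i-1) (x) cap^(p-i)); the casts only identify
   p - 1 + (p - i) = 2p - i - 1 = i - 1 + 2 (p - i) and i - 1 + 0 = i - 1. *)
Definition diagram p i (hi : (0 < i < p)%N) :
    'Hom(tpow K i.-1, tpow K (2 * p - i - 1)) :=
  (casth (dim_JW hi) (dim_JW hi) (tens (JW p.-1) (strands K (p - i)))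
   \o casth (addn0 i.-1) (dim_ncap hi)
        (tens (strands K i.-1) (ncap (p - i))))%VF.

End QuantumGroup.

(* Main.v *)
(* Write nu_w for the basis tensor of a word w, |w| for its number of nu_1's,
   and inv01 w, inv10 w for the number of pairs nu_0 before nu_1, respectively
   nu_1 before nu_0.  The q-symmetric tensors
     S(n,k) = sum of q^(- inv01 w) nu_w over the words w of length n, |w| = k
   satisfy F^k x_(0,n) = [k]! S(n,k), and the Jones-Wenzl recursion gives
     f_n nu_w = q^(inv10 w) [|w|]! [n - |w|]! / [n]! S(n,|w|).
   The nested cap sums (up to signs and powers of q) the words u u', u' being
   the reversed complement of u.  Since q^p = -1, [a]! [b]! = [p-1]! as soon as
   a + b = p - 1; hence the coefficient of f_(p-1) nu_(w u) loses its factorials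
   and the sum over u reassembles S(2p-i-1, |w|+p-i). *)
Require Import Defs.
From mathcomp Require Import all_boot all_order all_algebra.
From mathcomp Require Import zify ring complex.
From mathcomp Require Import reals trigo.

Set Implicit Arguments.
Unset Strict Implicit.
Unset Printing Implicit Defensive.

Import Order.TTheory GRing.Theory Num.Theory.
Local Open Scope ring_scope.

(** * Tensor powers of X, with coefficients indexed by words *)

Section Words.
Variable K : fieldType.

Lemma freemod_expand (I : finType) (v : freemod K I) :
  v = \sum_i (v i : K) *: ket K i.
Proof.
apply/ffunP=> j; rewrite sum_ffunE (bigD1 j) //= big1 => [|i ij].
  by rewrite addr0 !ffunE eqxx /GRing.scale /= mulr1.
by rewrite !ffunE eq_sym (negPf ij) /GRing.scale /= mulr0.
Qed.

Lemma hom_ket_ext (I : finType) (V : vectType K) (f g : 'Hom(freemod K I, V)) :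
  (forall i, f (ket K i) = g (ket K i)) -> f = g.
Proof.
move=> fg; apply/lfunP=> v; rewrite [v]freemod_expand !linear_sum.
by apply: eq_bigr => i _; rewrite !linearZ /= fg.
Qed.

(* Coefficients are functions of untyped words, so that casts between equal
   tensor powers leave F unchanged (castv_vec). *)
Definition vec n (F : seq bool -> K) : tpow K n := [ffun w => F (val w)].

Lemma vec_surj n (u : tpow K n) : exists F, u = vec n F.
Proof.
exists (fun s => if insub s is Some t then u t else 0).
by apply/ffunP=> w; rewrite ffunE valK.
Qed.

Lemma eq_vec n (F G : seq bool -> K) :
  (forall s, size s = n -> F s = G s) -> vec n F = vec n G.
Proof. by move=> FG; apply/ffunP=> w; rewrite !ffunE FG // size_tuple. Qed.

Lemma vecD n (F G : seq bool -> K) : vec n F + vec n G = vec n (fun s => F s + G s).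
Proof. by apply/ffunP=> w; rewrite !ffunE. Qed.

Lemma vecZ n a (F : seq bool -> K) : a *: vec n F = vec n (fun s => a * F s).
Proof. by apply/ffunP=> w; rewrite !ffunE. Qed.

Lemma vec_sum n (J : Type) (r : seq J) (F : J -> seq bool -> K) :
  \sum_(j <- r) vec n (F j) = vec n (fun s => \sum_(j <- r) F j s).
Proof.
by apply/ffunP=> w; rewrite sum_ffunE ffunE; apply: eq_bigr => j _; rewrite ffunE.
Qed.

Definition sket n (s : seq bool) : tpow K n := vec n (fun t => (t == s)%:R).

Lemma ketE n (w : n.-tuple bool) : ket K w = sket n w.
Proof. by apply/ffunP=> t; rewrite !ffunE. Qed.

Definition castv m n (e : m = n) (v : tpow K m) : tpow K n :=
  ecast k (tpow K k) e v.

Lemma castv_vec m n (e : m = n) F : castv e (vec m F) = vec n F.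
Proof. by case: _ / e. Qed.

Lemma castvD m n (e : m = n) u v : castv e (u + v) = castv e u + castv e v.
Proof. by case: _ / e. Qed.

Lemma castvZ m n (e : m = n) a u : castv e (a *: u) = a *: castv e u.
Proof. by case: _ / e. Qed.

Lemma castv_sum m n (e : m = n) (J : Type) (r : seq J) (f : J -> tpow K m) :
  castv e (\sum_(j <- r) f j) = \sum_(j <- r) castv e (f j).
Proof. by case: _ / e. Qed.

Lemma castvK m n (e : m = n) : cancel (castv e) (castv (esym e)).
Proof. by case: _ / e. Qed.

Lemma casthE m m' n n' (em : m = m') (en : n = n') (f : 'Hom(tpow K m, tpow K n)) v :
  casth em en f v = castv en (f (castv (esym em) v)).
Proof. by case: _ / em v => v; case: _ / en. Qed.

Lemma val_word_l m n (w : (m + n).-tuple bool) : val (word_l w) = take m w.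
Proof.
apply: (@eq_from_nth _ false) => [|j].
  by rewrite size_tuple size_takel // size_tuple leq_addr.
rewrite size_tuple => jm; rewrite nth_take //.
by rewrite -(tnth_nth _ _ (Ordinal jm)) tnth_mktuple (tnth_nth false).
Qed.

Lemma val_word_r m n (w : (m + n).-tuple bool) : val (word_r w) = drop m w.
Proof.
apply: (@eq_from_nth _ false) => [|j].
  by rewrite size_drop !size_tuple addKn.
rewrite size_tuple => jm; rewrite nth_drop.
by rewrite -(tnth_nth _ _ (Ordinal jm)) tnth_mktuple (tnth_nth false).
Qed.

Lemma tensv_vec m n F G :
  tensv (vec m F) (vec n G) = vec (m + n) (fun s => F (take m s) * G (drop m s)).
Proof. by apply/ffunP=> w; rewrite !ffunE val_word_l val_word_r. Qed.

Lemma tensv_sket m n s t : size s = m ->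
  tensv (sket m s) (sket n t) = sket (m + n) (s ++ t).
Proof.
move=> sm; rewrite /sket tensv_vec; apply: eq_vec => x sx.
by rewrite -natrM mulnb -{3}(cat_take_drop m x) eqseq_cat //
  size_takel ?sm ?sx ?leq_addr.
Qed.

Lemma tensvDl m n (u u' : tpow K m) (v : tpow K n) :
  tensv (u + u') v = tensv u v + tensv u' v.
Proof. by apply/ffunP=> w; rewrite !ffunE mulrDl. Qed.

Lemma tensvDr m n (u : tpow K m) (v v' : tpow K n) :
  tensv u (v + v') = tensv u v + tensv u v'.
Proof. by apply/ffunP=> w; rewrite !ffunE mulrDr. Qed.

Lemma tensvZl m n a (u : tpow K m) (v : tpow K n) :
  tensv (a *: u) v = a *: tensv u v.
Proof. by apply/ffunP=> w; rewrite !ffunE /GRing.scale /= mulrA. Qed.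

Lemma tensvZr m n a (u : tpow K m) (v : tpow K n) :
  tensv u (a *: v) = a *: tensv u v.
Proof. by apply/ffunP=> w; rewrite !ffunE /GRing.scale /= mulrCA. Qed.

Lemma tensv0l m n (v : tpow K n) : tensv (0 : tpow K m) v = 0.
Proof. by apply/ffunP=> w; rewrite !ffunE mul0r. Qed.

Lemma tensv0r m n (u : tpow K m) : tensv u (0 : tpow K n) = 0.
Proof. by apply/ffunP=> w; rewrite !ffunE mulr0. Qed.

Lemma tensv_suml m n (J : Type) (r : seq J) (f : J -> tpow K m) (v : tpow K n) :
  tensv (\sum_(j <- r) f j) v = \sum_(j <- r) tensv (f j) v.
Proof.
by apply: (big_morph (fun u => tensv u v)) => [u u'|]; rewrite ?tensvDl ?tensv0l.
Qed.

Lemma tensv_sumr m n (J : Type) (r : seq J) (u : tpow K m) (f : J -> tpow K n) :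
  tensv u (\sum_(j <- r) f j) = \sum_(j <- r) tensv u (f j).
Proof.
by apply: (big_morph (tensv u)) => [v v'|]; rewrite ?tensvDr ?tensv0r.
Qed.

(** Both sides are bilinear in [u] and [v], and on basis words splitting [x ++ y] gives back [x] and
    [y]. *)
Lemma tens_tensv m m' n n' (f : 'Hom(tpow K m, tpow K m'))
    (g : 'Hom(tpow K n, tpow K n')) u v :
  tens f g (tensv u v) = tensv (f u) (g v).
Proof.
rewrite [u]freemod_expand [v]freemod_expand !linear_sum /= !tensv_suml linear_sum.
apply: eq_bigr => x _; rewrite !tensv_sumr linear_sum; apply: eq_bigr => y _.
rewrite [f _]linearZ [g _]linearZ /= !tensvZl !tensvZr.
rewrite [tens f g _]linearZ /= [tens f g _]linearZ /=; congr (_ *: (_ *: _)).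
have -> : tensv (ket K x) (ket K y) = ket K [tuple of x ++ y].
  by rewrite !ketE tensv_sket ?size_tuple.
rewrite /tens lext_ket; congr (tensv (f (ket K _)) (g (ket K _))); apply: val_inj.
  by rewrite val_word_l /= take_size_cat ?size_tuple.
by rewrite val_word_r /= drop_size_cat ?size_tuple.
Qed.

(** The Jones-Wenzl recursion adds strands on the right, so vectors are built from that end. *)
Definition snoc n (a : bool) (u : tpow K n) : tpow K n.+1 :=
  castv (addn1 n) (tensv u (ket K [tuple a])).

Lemma snocD n a (u v : tpow K n) : snoc a (u + v) = snoc a u + snoc a v.
Proof. by rewrite /snoc tensvDl castvD. Qed.

Lemma snocZ n a c (u : tpow K n) : snoc a (c *: u) = c *: snoc a u.
Proof. by rewrite /snoc tensvZl castvZ. Qed.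

Lemma snoc0 n a : snoc a (0 : tpow K n) = 0.
Proof. by rewrite -[X in snoc a X](scale0r 0) snocZ scale0r. Qed.

Lemma snoc_vec n a F :
  snoc a (vec n F) = vec n.+1 (fun s => F (take n s) * (drop n s == [:: a])%:R).
Proof. by rewrite /snoc ketE /sket tensv_vec castv_vec. Qed.

Lemma snoc_sket n a s : size s = n -> snoc a (sket n s) = sket n.+1 (rcons s a).
Proof. by move=> sn; rewrite /snoc ketE tensv_sket // castv_vec /= cats1. Qed.

(** Brings two appended letters into the form on which [TL_last] acts. *)
Lemma snoc2 n a b (u : tpow K n) :
  snoc b (snoc a u) = castv (addn2 n) (tensv u (ket K [tuple a; b])).
Proof.
have [F ->] := vec_surj u; rewrite !snoc_vec !ketE /sket !tensv_vec castv_vec.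
apply: eq_vec => s sn; rewrite take_takel // -mulrA; congr (_ * _).
rewrite -natrM mulnb /=; congr ((nat_of_bool _)%:R).
case/lastP: s sn => // s y; rewrite size_rcons => -[]; case/lastP: s => // s x.
rewrite size_rcons => -[<-].
rewrite -(cats1 _ y) take_size_cat ?size_rcons // drop_size_cat ?size_rcons //.
rewrite -cats1 drop_size_cat // -catA drop_size_cat // /=.
by rewrite !eqseq_cons !eqxx !andbT.
Qed.

Lemma add_strand_snoc n (f : 'End(tpow K n)) a u :
  add_strand f (snoc a u) = snoc a (f u).
Proof. by rewrite /add_strand casthE castvK tens_tensv lfunE. Qed.

End Words.

(** * Inversion statistics of binary words *)

Section Inversions.
Local Open Scope nat_scope.

Definition ones (s : seq bool) := count id s.
Definition zeros (s : seq bool) := count negb s.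

Fixpoint inv01 (s : seq bool) : nat :=
  if s is a :: s' then ~~ a * ones s' + inv01 s' else 0.

Fixpoint inv10 (s : seq bool) : nat :=
  if s is a :: s' then a * zeros s' + inv10 s' else 0.

Lemma ones_zeros s : ones s + zeros s = size s.
Proof. by rewrite /ones /zeros -(count_predC id s). Qed.

Lemma zerosE s : zeros s = size s - ones s.
Proof. by rewrite -(ones_zeros s) addKn. Qed.

Lemma ones_cat s t : ones (s ++ t) = ones s + ones t.
Proof. exact: count_cat. Qed.

Lemma zeros_cat s t : zeros (s ++ t) = zeros s + zeros t.
Proof. exact: count_cat. Qed.

Lemma inv01_cat s t : inv01 (s ++ t) = inv01 s + inv01 t + zeros s * ones t.
Proof.
elim: s => [|a s IH] /=; first by rewrite addn0.
by rewrite IH ones_cat; case: a => /=; lia.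
Qed.

Lemma inv10_cat s t : inv10 (s ++ t) = inv10 s + inv10 t + ones s * zeros t.
Proof.
elim: s => [|a s IH] /=; first by rewrite addn0.
by rewrite IH zeros_cat; case: a => /=; lia.
Qed.

Lemma inv01_rcons s a : inv01 (rcons s a) = inv01 s + zeros s * a.
Proof. by rewrite -cats1 inv01_cat /= /ones /= muln0 !addn0. Qed.

Lemma inv10_rcons s a : inv10 (rcons s a) = inv10 s + ones s * ~~ a.
Proof. by rewrite -cats1 inv10_cat /= /zeros /= muln0 !addn0. Qed.

Lemma ones_rcons s a : ones (rcons s a) = ones s + a.
Proof. by rewrite -cats1 ones_cat /ones /= addn0. Qed.

Lemma zeros_rcons s a : zeros (rcons s a) = zeros s + ~~ a.
Proof. by rewrite -cats1 zeros_cat /zeros /= addn0. Qed.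

(** Each pair of a nu_0 and a nu_1 is counted by exactly one of the two statistics. *)
Lemma inv01_inv10 s : inv01 s + inv10 s = ones s * zeros s.
Proof.
elim: s => [|a s IH] //=; case: a; rewrite /ones /zeros /= -/(ones s) -/(zeros s).
  by move: IH; nia.
by move: IH; nia.
Qed.

End Inversions.

(** * Jones-Wenzl projections on q-symmetric tensors and on basis tensors *)

Section JonesWenzl.
Variables (K : fieldType) (q : K).
Hypothesis q0 : q != 0.

Local Notation qn := (qint q).


Lemma qint0 : qn 0 = 0.
Proof. by rewrite /qint expr0 invr1 subrr mul0r. Qed.

Lemma qintD m n : qn (m + n) = q ^+ m * qn n + q ^- n * qn m.
Proof.
rewrite /qint !mulrA -mulrDl; congr (_ / _).
rewrite !mulrBr exprD invfM.
by rewrite [q ^- n * q ^+ m]mulrC addrA subrK [q ^- n * _]mulrC.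
Qed.

(** The tensor S(n,k) of the overview. *)
Definition qsym n k : tpow K n :=
  vec n (fun s => (ones s == k)%:R * q ^- inv01 s).

Lemma qsym_gt n k : (n < k)%N -> qsym n k = 0.
Proof.
move=> nk; apply/ffunP=> w; rewrite !ffunE.
have := ones_zeros w; rewrite size_tuple => e.
by rewrite (_ : (_ == k) = false) ?mul0r //; apply/eqP; move: e nk => /=; lia.
Qed.

Lemma qsym_rcons0 n : qsym n.+1 0 = snoc false (qsym n 0).
Proof.
rewrite /qsym snoc_vec; apply: eq_vec => s; case/lastP: s => // s a.
rewrite size_rcons => -[sn]; rewrite -cats1 take_size_cat // drop_size_cat // cats1.
rewrite ones_rcons inv01_rcons addn_eq0 eqseq_cons andbT.
by case: a; rewrite ?andbF ?mul0r ?mulr0 // andbT muln0 addn0 mulr1.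
Qed.

(** Split on the last letter: a final nu_1 forms an inversion with each of the n - k letters nu_0
    before it. *)
Lemma qsym_rconsS n k : qsym n.+1 k.+1 =
  snoc false (qsym n k.+1) + q ^- (n - k) *: snoc true (qsym n k).
Proof.
rewrite /qsym !snoc_vec vecZ vecD; apply: eq_vec => s; case/lastP: s => // s a.
rewrite size_rcons => -[sn]; rewrite -cats1 take_size_cat // drop_size_cat // cats1.
rewrite ones_rcons inv01_rcons zerosE sn !eqseq_cons !andbT.
case: a => /=; rewrite ?(addn0, addn1, muln0, muln1, mulr0, mulr1, addr0, add0r) //.
rewrite eqSS; case: eqP => [->|_]; rewrite ?mul0r ?mulr0 // !mul1r.
by rewrite addnC exprD invfM.
Qed.

(** The scalar is the value of the cup on [a], [b]; the vector is the cap. *)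
Lemma TL_last_snoc n a b (u : tpow K n) :
  TL_last q n (snoc b (snoc a u)) =
  (if a == b then 0 else if a then 1 else - q)
    *: (q^-1 *: snoc false (snoc true u) - snoc true (snoc false u)).
Proof.
rewrite -scaleN1r !snoc2 -!castvZ -castvD -!tensvZr -tensvDr -castvZ -tensvZr.
rewrite /TL_last casthE castvK tens_tensv lfunE /= lfunE /=.
congr (castv _ (tensv _ _)); rewrite scaleN1r.
have capE c : cap q (c *: ket K [tuple]) =
   c *: (q^-1 *: ket K [tuple true; false] - ket K [tuple false; true]).
  by rewrite linearZ /= /cap lext_ket.
rewrite /cup lext_ket.
by case: a; case: b; rewrite /= ?linear0 ?scale0r // -?capE ?scale1r.
Qed.

(** Only the part of S(n+1,k+1) ending in nu_1 survives the cup with the appended nu_0. *)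
Lemma TL_last_false n k : TL_last q n (snoc false (qsym n.+1 k.+1)) =
  q ^- (n - k) *: (q^-1 *: snoc false (snoc true (qsym n k))
                   - snoc true (snoc false (qsym n k))).
Proof.
rewrite qsym_rconsS snocD snocZ linearD linearZ /= !TL_last_snoc /=.
by rewrite scale0r add0r scale1r.
Qed.

Lemma TL_last_true n k : TL_last q n (snoc true (qsym n.+1 k)) =
  - q *: (q^-1 *: snoc false (snoc true (qsym n k))
          - snoc true (snoc false (qsym n k))).
Proof.
case: k => [|k]; first by rewrite qsym_rcons0 TL_last_snoc.
rewrite qsym_rconsS snocD snocZ linearD linearZ /= !TL_last_snoc /=.
by rewrite scale0r scaler0 addr0.
Qed.

Lemma JWSS n v : JW q n.+2 v =
  add_strand (JW q n.+1) v
  - (qn n.+1 / qn n.+2) *: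
    add_strand (JW q n.+1) (TL_last q n (add_strand (JW q n.+1) v)).
Proof.
rewrite -[JW q n.+2]/(let g := add_strand (JW q n.+1) in
   g - (qn n.+1 / qn n.+2) *: (g \o TL_last q n \o g)%VF) /=.
by rewrite add_lfunE opp_lfunE scale_lfunE !comp_lfunE.
Qed.

(** The induction statement; it implies [JW_qsym_fix], which the next induction step uses. *)
Definition JW_qsym_rcons n := forall k,
  JW q n.+1 (snoc false (qsym n k)) =
    (q ^+ k * qn (n.+1 - k) / qn n.+1) *: qsym n.+1 k /\
  JW q n.+1 (snoc true (qsym n k)) = (qn k.+1 / qn n.+1) *: qsym n.+1 k.+1.

(** After splitting off the last letter, q^(k+1) [n-k] and q^(-(n-k)) [k+1] add up to [n+1] by
    [qintD]. *)
Lemma JW_qsym_fix n : qn n.+1 != 0 -> JW_qsym_rcons n ->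
  forall k, JW q n.+1 (qsym n.+1 k) = qsym n.+1 k.
Proof.
move=> n0 H [|k].
  by rewrite qsym_rcons0 (H 0).1 -qsym_rcons0 subn0 expr0 mul1r divff // scale1r.
have [nk|kn] := ltnP n k; first by rewrite qsym_gt // linear0.
rewrite {1}qsym_rconsS linearD linearZ /= (H k.+1).1 (H k).2 scalerA -scalerDl.
rewrite [q ^- _ * _]mulrA -mulrDl subSS.
have -> : n.+1 = (k.+1 + (n - k))%N by lia.
rewrite -qintD divff ?scale1r //.
by have -> : (k.+1 + (n - k))%N = n.+1 by lia.
Qed.

(** In the recursion for f_(n+2), the inner f_(n+1) fixes its q-symmetric argument, [TL_last] leaves
    a q-symmetric tensor on n strands followed by two letters, and the induction hypothesis
    evaluates the outer f_(n+1) on it. *)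
Lemma JW_qsym_rconsP n : (forall j, (0 < j <= n.+1)%N -> qn j != 0) ->
  JW_qsym_rcons n.
Proof.
elim: n => [|n IH] nz.
  have n1 : qn 1 != 0 by rewrite nz.
  case=> [|k]; last first.
    (* S(1,1) is not zero; in the first identity it is the coefficient [0] that vanishes. *)
    rewrite [qsym 0 _]qsym_gt // [qsym 1 k.+2]qsym_gt // !snoc0 !linear0.
    by rewrite subSS sub0n qint0 mulr0 mul0r scale0r.
  rewrite -[JW q 1]/(strands K 1) !id_lfunE subn0 expr0 mul1r divff //.
  rewrite !scale1r qsym_rcons0.
  by rewrite qsym_rconsS [qsym 0 1]qsym_gt // snoc0 add0r expr0 invr1 scale1r.
have nz1 : qn n.+1 != 0 by rewrite nz // leqnSn.
have nz2 : qn n.+2 != 0 by rewrite nz // leqnn.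
have {}IH : JW_qsym_rcons n by apply: IH => j jn; apply: nz; lia.
have fix1 := JW_qsym_fix nz1 IH.
move=> k; split.
  rewrite JWSS add_strand_snoc fix1.
  case: k => [|k].
    rewrite qsym_rcons0 TL_last_snoc scale0r linear0 scaler0 subr0 -qsym_rcons0.
    by rewrite -qsym_rcons0 subn0 expr0 mul1r divff // scale1r.
  rewrite TL_last_false !(linearZ, linearB) /= !add_strand_snoc (IH k).1 (IH k).2.
  rewrite !snocZ.
  have [nk|kn] := ltnP n k.
    rewrite [qsym n.+1 k.+1]qsym_gt // (_ : n.+1 - k = 0)%N; last by lia.
    rewrite subSS (_ : n.+1 - k = 0)%N; last by lia.
    by rewrite snoc0 qint0 !(mulr0, mul0r, scale0r, scaler0, subr0, oppr0, addr0).
  rewrite [qsym n.+2 _]qsym_rconsS !subSS (subSn kn).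
  set r := (n - k)%N.
  (* With [n+2] expressed this way the remaining q-integers can be treated as independent variables,
     and the goal is a rational identity. *)
  have e2 : qn n.+2 = q ^+ k.+1 * qn r.+1 + q ^- r.+1 * qn k.+1.
    by rewrite -qintD; congr qn; rewrite /r; lia.
  rewrite e2 in nz2 *.
  move: (snoc false _) (snoc true _) => X Y.
  apply/ffunP=> w; rewrite !ffunE /GRing.scale /=.
  move: (X w) (Y w) => x y.
  rewrite !exprS in nz2 *.
  move: nz1 nz2 (expf_neq0 k q0) (expf_neq0 r q0).
  move: (qn r.+1) (qn k.+1) (qn n.+1) (q ^+ k) (q ^+ r).
  move=> A B N a b N0 D a0 b0; field.
  (* The denominator left by [field] is q^(r+1) [n+2]. *)
  have -> : q * a * A * (q * b) + B = (q * b) * (q * a * A + (q * b)^-1 * B).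
    by field; rewrite q0 b0.
  by rewrite q0 b0 N0 !mulf_neq0.
have [nk|kn] := ltnP n.+1 k.
  by rewrite !qsym_gt // snoc0 linear0 scaler0.
rewrite JWSS add_strand_snoc fix1 TL_last_true.
rewrite !(linearZ, linearB) /= !add_strand_snoc (IH k).1 (IH k).2.
rewrite !snocZ [qsym n.+2 _]qsym_rconsS.
set r := (n.+1 - k)%N.
have e2 : qn n.+2 = q ^+ k.+1 * qn r + q ^- r * qn k.+1.
  by rewrite -qintD; congr qn; rewrite /r; lia.
rewrite e2 in nz2 *.
move: (snoc false _) (snoc true _) => X Y.
apply/ffunP=> w; rewrite !ffunE /GRing.scale /=.
move: (X w) (Y w) => x y.
rewrite !exprS in nz2 *.
move: nz1 nz2 (expf_neq0 k q0) (expf_neq0 r q0).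
move: (qn r) (qn k.+1) (qn n.+1) (q ^+ k) (q ^+ r).
move=> A B N a b N0 D a0 b0; field.
have -> : q * a * A * b + B = b * (q * a * A + b^-1 * B) by field; rewrite b0.
by rewrite q0 b0 N0 !mulf_neq0.
Qed.

Lemma qfactS n : qfact q n.+1 = qfact q n * qn n.+1.
Proof. by rewrite /qfact big_nat_recr. Qed.

Lemma qfact0 : qfact q 0 = 1.
Proof. by rewrite /qfact big_nil. Qed.

Lemma qfact_neq0 n : (forall j, (0 < j <= n)%N -> qn j != 0) -> qfact q n != 0.
Proof.
elim: n => [|n IH] nz; first by rewrite qfact0 oner_eq0.
by rewrite qfactS mulf_neq0 ?nz ?leqnn // IH // => j jn; apply: nz; lia.
Qed.

Definition JW_coef s : K :=
  q ^+ inv10 s * (qfact q (ones s) * qfact q (zeros s) / qfact q (size s)).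

(** Induction on the last letter. In the recursion f_(n+1) acts first through f_n, so the prefix may
    be replaced by its image under f_n, a multiple of S(n,|s|), which f_n fixes; [JW_qsym_rconsP]
    then applies. *)
Lemma JW_sket n s : (forall j, (0 < j <= n)%N -> qn j != 0) -> size s = n ->
  JW q n (sket K n s) = JW_coef s *: qsym n (ones s).
Proof.
elim: n s => [|n IH] s nz.
  case: s => // _; rewrite -[JW q 0]/(strands K 0) id_lfunE /JW_coef /= qfact0.
  rewrite expr0 mulr1 mul1r divr1 scale1r; apply: eq_vec => -[|//] _.
  by rewrite /= expr0 invr1 mulr1.
have nzn j : (0 < j <= n)%N -> qn j != 0 by move=> jn; apply: nz; lia.
case/lastP: s => // s a; rewrite size_rcons => -[sn]; rewrite -snoc_sket //.
have -> : JW q n.+1 (snoc a (sket K n s)) =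
          JW_coef s *: JW q n.+1 (snoc a (qsym n (ones s))).
  case: n IH nz nzn sn => [|n] IH nz nzn sn.
    have := IH s nzn sn; rewrite -[JW q 0]/(strands K 0) id_lfunE => ->.
    by rewrite snocZ linearZ.
  rewrite !JWSS !add_strand_snoc IH // JW_qsym_fix ?nz ?leqnSn //; last first.
    exact: JW_qsym_rconsP.
  rewrite snocZ.
  rewrite [TL_last q n (_ *: _)]linearZ /= [add_strand _ (_ *: _)]linearZ /=.
  by rewrite scalerBr !scalerA [_ * JW_coef s]mulrC.
have nz1 := nz n.+1; have /(_ (ones s)) [e0 e1] := JW_qsym_rconsP nz.
have f0 : qfact q n != 0 by exact: qfact_neq0.
rewrite ltnSn /= in nz1; have {}nz1 := nz1 isT.
have os := ones_zeros s; case: a.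
  rewrite e1 scalerA ones_rcons addn1; congr (_ *: _).
  rewrite /JW_coef ones_rcons zeros_rcons inv10_rcons size_rcons sn !addn0 muln0 addn0.
  by rewrite addn1 !qfactS; field; rewrite ?f0 ?nz1.
rewrite e0 scalerA ones_rcons addn0; congr (_ *: _).
rewrite /JW_coef ones_rcons zeros_rcons inv10_rcons size_rcons sn addn0 addn1 muln1.
rewrite (_ : n.+1 - ones s = (zeros s).+1)%N; last by lia.
by rewrite !qfactS exprD; field; rewrite ?f0 ?nz1.
Qed.

End JonesWenzl.

(** * Powers of F applied to x_(0,n) *)

Section PowersOfF.
Variables (K : fieldType) (q : K).
Hypotheses (q0 : q != 0) (nz1 : qint q 1 != 0).

(** When q = q^-1 the quotient is 0 by the convention on division; [nz1] excludes this. *)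
Lemma qint1 : qint q 1 = 1.
Proof. by move: nz1; rewrite /qint mulf_eq0 => /norP[n0 _]; rewrite divff. Qed.

Lemma qintS k : qint q k.+1 = q * qint q k + q ^- k.
Proof. by rewrite -add1n qintD // qint1 expr1 mulr1. Qed.

(** Injectivity is what allows K^-1 in the coproduct of F to be cancelled against K. The K of
    parameter [q^-1] is a left inverse. *)
Lemma X_K_inj : lker (uqK (X_action q)) == 0%VS.
Proof.
have KK : (uqK (X_action q^-1) \o uqK (X_action q))%VF = \1%VF.
  apply: hom_ket_ext => w; case/tupleP: w => a w; rewrite (tuple0 w).
  rewrite comp_lfunE id_lfunE lext_ket theadE.
  by case: a; rewrite linearZ /= lext_ket /= scalerA ?invrK ?mulfV ?mulVf // scale1r;
     congr (ket K _); apply: val_inj.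
apply/lker0P=> u v uv.
by rewrite -[u]id_lfunE -KK comp_lfunE uv -comp_lfunE KK id_lfunE.
Qed.

Lemma X_Kinv_nu0 : ((uqK (X_action q))^-1)%VF (nu0 K) = q^-1 *: nu0 K.
Proof.
have Ke : uqK (X_action q) (q^-1 *: nu0 K) = nu0 K.
  by rewrite linearZ /= lext_ket /= scalerA mulVf // scale1r.
by rewrite -{1}Ke lker0_lfunK // X_K_inj.
Qed.

Lemma X_Kinv_nu1 : ((uqK (X_action q))^-1)%VF (nu1 K) = q *: nu1 K.
Proof.
have Ke : uqK (X_action q) (q *: nu1 K) = nu1 K.
  by rewrite linearZ /= lext_ket /= scalerA mulfV // scale1r.
by rewrite -{1}Ke lker0_lfunK // X_K_inj.
Qed.

Lemma qsym_cons0 n : qsym q n.+1 0 = tensv (nu0 K) (qsym q n 0).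
Proof.
rewrite /nu0 ketE /sket /qsym tensv_vec; apply: eq_vec => -[|a s] //= _.
rewrite take0 drop0 eqseq_cons andbT /ones /= -/(ones s).
case: a => /=; first by rewrite !mul0r.
rewrite mul1r mul1n add0n.
by case: eqP => [->|_]; rewrite ?mul0r.
Qed.

(** Split on the first letter, where [tpow_action] recurses: a leading nu_0 forms an inversion with
    each of the k + 1 letters nu_1 after it. *)
Lemma qsym_consS n k : qsym q n.+1 k.+1 =
  tensv (nu1 K) (qsym q n k) + q ^- k.+1 *: tensv (nu0 K) (qsym q n k.+1).
Proof.
rewrite /nu0 /nu1 !ketE /sket /qsym !tensv_vec vecZ vecD.
apply: eq_vec => -[|a s] //= _.
rewrite take0 drop0 !eqseq_cons !andbT /ones /= -/(ones s).
case: a => /=; first by rewrite add1n eqSS mul0r mulr0 addr0 mul1r.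
rewrite mul0r add0r mul1r mul1n add0n.
by case: eqP => [->|_]; rewrite ?mul0r ?mulr0 // !mul1r exprD invfM.
Qed.

Lemma tens_action_F m n (a : uq_action (tpow K m)) (b : uq_action (tpow K n)) u v :
  uqF (tens_action a b) (tensv u v) =
  tensv (uqF a u) v + tensv ((uqK a)^-1%VF u) (uqF b v).
Proof. by rewrite add_lfunE !tens_tensv id_lfunE. Qed.

(** F acts on the first letter, or on the rest with K^-1 on the first letter. The two contributions
    to nu_1 (x) S(n,k+1) add up to q [k+1] + q^(-(k+1)) = [k+2]. *)
Lemma uqF_qsym n k :
  uqF (tpow_action q n) (qsym q n k) = qint q k.+1 *: qsym q n k.+1.
Proof.
elim: n k => [|n IH] k; first by rewrite zero_lfunE qsym_gt ?scaler0.
have F0 : uqF (X_action q) (nu0 K) = nu1 K by rewrite lext_ket.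
have F1 : uqF (X_action q) (nu1 K) = 0 by rewrite lext_ket.
have FE (u : tpow K 1) (v : tpow K n) : uqF (tpow_action q n.+1) (tensv u v) =
    tensv (uqF (X_action q) u) v
    + tensv ((uqK (X_action q))^-1%VF u) (uqF (tpow_action q n) v).
  exact (tens_action_F (X_action q) (tpow_action q n) u v).
case: k => [|k].
  rewrite qsym_cons0 FE F0 X_Kinv_nu0 IH tensvZl tensvZr qint1 !scale1r.
  by rewrite qsym_consS expr1.
rewrite {1}qsym_consS linearD linearZ /= !FE F0 F1 X_Kinv_nu0 X_Kinv_nu1 !IH.
rewrite qsym_consS tensv0l add0r !tensvZl !tensvZr.
rewrite [qint q k.+2]qintS.
move: (tensv (nu1 K) _) (tensv (nu0 K) _) => U V.
apply/ffunP=> w; rewrite !ffunE /GRing.scale /= !exprS.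
move: (U w) (V w) (expf_neq0 k q0) => x y qk.
field.
by rewrite q0 qk.
Qed.

Lemma iter_uqF n k :
  iter k (uqF (tpow_action q n)) (x0 K n) = qfact q k *: qsym q n k.
Proof.
elim: k => [|k IH] /=.
  rewrite qfact0 scale1r /x0 ketE; apply: eq_vec => s sn /=.
  have -> : (s == nseq n false) = (ones s == 0%N).
    rewrite -sn; elim: s {sn} => // a s IH /=; rewrite eqseq_cons IH.
    by rewrite /ones /=; case: a.
  case: eqP => [o0|_]; last by rewrite mul0r.
  have := inv01_inv10 s; rewrite o0 mul0n => /eqP; rewrite addn_eq0 => /andP[/eqP -> _].
  by rewrite expr0 invr1 mulr1.
by rewrite IH linearZ /= uqF_qsym scalerA -qfactS.
Qed.

End PowersOfF.

(** * Symmetry of q-integers and q-factorials when q^p = -1 *)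

Section RootOfUnity.
Variables (K : fieldType) (q : K) (p : nat).

Hypotheses (q0 : q != 0) (qp : q ^+ p = -1).

(** As q^a = - q^(-b), the two terms of the numerator are merely exchanged. *)
Lemma qint_sym a b : (a + b = p)%N -> qint q a = qint q b.
Proof.
move=> ab; rewrite /qint; congr (_ / _).
have qa : q ^+ a = - q ^- b.
  by apply: (mulIf (expf_neq0 b q0)); rewrite -exprD ab qp mulNr mulVf ?expf_neq0.
by rewrite qa invrN invrK opprK addrC.
Qed.

(** Since [b+1] = [a+1] when a + b + 2 = p, one factor at a time moves from the second factorial to
    the first. *)
Lemma qfact_sym a b : ((a + b).+1 = p)%N ->
  qfact q a * qfact q b = qfact q p.-1.
Proof.
elim: b a => [|b IH] a ab.
  by rewrite qfact0 mulr1 -ab addn0.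
rewrite qfactS (@qint_sym b.+1 a.+1); last by lia.
by rewrite -(IH a.+1) ?qfactS; [ring | lia].
Qed.

End RootOfUnity.

(** * Transfer of e^(i pi / p) from the complex numbers to K *)

Lemma de_moivre (R : realType) (x : R) n :
  ((cos x +i* sin x) ^+ n = cos (n%:R * x) +i* sin (n%:R * x))%C.
Proof.
elim: n => [|n IH]; first by rewrite expr0 mul0r cos0 sin0.
rewrite exprSr IH [n.+1%:R]mulrSr mulrDl mul1r cosD sinD.
by apply/eqP; rewrite eq_complex /= eqxx addrC eqxx.
Qed.

(** The properties are established for [z] in [L] through its complex image, then carried to [K],
    field morphisms being injective. *)
Lemma exp_ipi_over_root (R : realType) (K : fieldType) (p : nat) (q : K) :
  (2 <= p)%N -> is_exp_ipi_over R p q ->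
  [/\ q != 0, q ^+ p = -1 & forall j, (0 < j < p)%N -> qint q j != 0].
Proof.
move=> hp [L [toC [toK [z [zE <-]]]]].
have zX n : toC (z ^+ n) =
    (cos (n%:R * (pi / p%:R)) +i* sin (n%:R * (pi / p%:R)))%C.
  by rewrite rmorphXn /= zE de_moivre.
have p0 : p%:R != 0 :> R by rewrite pnatr_eq0; lia.
have zp : z ^+ p = -1.
  apply: (fmorph_inj toC); rewrite zX mulrC divfK // cospi sinpi rmorphN1.
  by apply/eqP; rewrite eq_complex /= oppr0 !eqxx.
have z0 : z != 0.
  apply/eqP=> z0; move/eqP: zp; rewrite z0 expr0n (_ : (p == 0)%N = false).
    by rewrite eq_sym oppr_eq0 oner_eq0.
  by lia.
(* Otherwise z^j is 1 or -1, so sin(j pi / p) = 0, whereas this sine is positive for 0 < j < p. *)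
have z2 j : (0 < j < p)%N -> z ^+ j - z ^- j != 0.
  move=> /andP[j0 jp]; rewrite subr_eq0; apply/eqP=> zj.
  have : z ^+ j * z ^+ j == 1 by rewrite {1}zj mulVf // expf_neq0.
  rewrite -expr2 sqrf_eq1.
  have s0 : sin (j%:R * (pi / p%:R)) != 0 :> R.
    apply: lt0r_neq0; apply: sin_gt0_pi.
    rewrite mulr_gt0 ?divr_gt0 ?pi_gt0 ?ltr0n //=; last by lia.
    rewrite mulrCA gtr_pMr ?pi_gt0 // ltr_pdivrMr ?mul1r ?ltr_nat //.
    by rewrite ltr0n; lia.
  move=> /orP[] /eqP /(congr1 toC); rewrite zX ?rmorphN1 ?rmorph1 => /eqP.
    by rewrite eq_complex /= (negPf s0) andbF.
  by rewrite eq_complex /= oppr0 (negPf s0) andbF.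
split; first by rewrite fmorph_eq0.
  by rewrite -rmorphXn zp rmorphN1.
move=> j jp; have -> : qint (toK z) j = toK (qint z j).
  by rewrite /qint fmorph_div !rmorphB !fmorphV !rmorphXn.
have z21 : z - z^-1 != 0 by have := z2 1%N; rewrite expr1; apply; lia.
by rewrite fmorph_eq0 mulf_neq0 ?invr_neq0 ?z2.
Qed.

(** * Reversed complements of words and the nested cap *)

Fixpoint words (n : nat) : seq (seq bool) :=
  if n is m.+1 then map (cons true) (words m) ++ map (cons false) (words m)
  else [:: [::]].

(** An arc joins positions k and 2m+1-k and carries opposite letters, so the right half of a word in
    the nested cap is [rc] of the left half. *)
Definition rc (s : seq bool) := rev (map negb s).

Lemma rc_cons a s : rc (a :: s) = rcons (rc s) (~~ a).
Proof. by rewrite /rc /= rev_cons. Qed.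

Lemma size_rc s : size (rc s) = size s.
Proof. by rewrite size_rev size_map. Qed.

Lemma size_words n s : s \in words n -> size s = n.
Proof.
elim: n s => [|n IH] s /=; first by rewrite inE => /eqP ->.
by rewrite mem_cat => /orP[] /mapP[t /IH <- ->].
Qed.

Lemma ones_rc s : ones (rc s) = zeros s.
Proof.
by elim: s => // a s IH; rewrite rc_cons ones_rcons IH addnC.
Qed.

Lemma zeros_rc s : zeros (rc s) = ones s.
Proof.
by elim: s => // a s IH; rewrite rc_cons zeros_rcons IH addnC negbK.
Qed.

(** Reversal and complement each exchange the two kinds of inversions. *)
Lemma inv01_rc s : inv01 (rc s) = inv01 s.
Proof.
by elim: s => // a s IH; rewrite rc_cons inv01_rcons IH zeros_rc addnC mulnC.
Qed.

(** [rc] permutes the words of length m, so exactly one term is 1. This serves to spread a single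
    coefficient over a sum indexed by u. *)
Lemma sum_words_rc (K : fieldType) m s : size s = m ->
  \sum_(u <- words m) (s == rc u)%:R = 1 :> K.
Proof.
elim: m s => [|m IH] s; first by case: s => //=; rewrite big_seq1.
case/lastP: s => // s a; rewrite size_rcons => -[/IH E] /=.
rewrite big_cat !big_map /=.
under eq_bigr do rewrite rc_cons eqseq_rcons.
under [X in _ + X]eq_bigr do rewrite rc_cons eqseq_rcons.
case: a => /=.
  under eq_bigr do rewrite andbF; under [X in _ + X]eq_bigr do rewrite andbT.
  by rewrite E big1 ?add0r //.
under eq_bigr do rewrite andbT; under [X in _ + X]eq_bigr do rewrite andbF.
by rewrite E big1 ?addr0 //.
Qed.

Section Caps.
Variables (K : fieldType) (q : K).

(** An arc whose left letter is nu_1 contributes q^-1, one whose left letter is nu_0 contributes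
    -1. *)
Definition cap_coef s : K := q ^- ones s * (-1) ^+ zeros s.

(** The outer arc puts a letter [a] before [u] and [~~ a] after [rc u], which gives [a :: u]
    followed by its own [rc]. *)
Lemma ncapE m : ncap q m (sket K 0 [::]) =
  \sum_(u <- words m) cap_coef u *: sket K (m + m) (u ++ rc u).
Proof.
elim: m => [|m IH].
  by rewrite big_seq1 id_lfunE /cap_coef /= mulr1 expr0 invr1 scale1r.
rewrite -[ncap q m.+1]/(casth (erefl 0%N) (ncap_eq m)
  (tens (tens (strands K 1) (ncap q m)) (strands K 1) \o cap q)%VF) casthE.
rewrite castv_vec -/(sket K 0 [::]) comp_lfunE.
have capE : cap q (sket K 0 [::]) =
    q^-1 *: sket K (1 + 0 + 1) [:: true; false] - sket K (1 + 0 + 1) [:: false; true].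
  by rewrite -[sket K 0 _](ketE K [tuple]) lext_ket !ketE.
have arc a b : castv (ncap_eq m)
    (tens (tens (strands K 1) (ncap q m)) (strands K 1) (sket K (1 + 0 + 1) [:: a; b])) =
    \sum_(u <- words m) cap_coef u *: sket K (m.+1 + m.+1) (a :: u ++ rcons (rc u) b).
  rewrite -[[:: a; b]]/(([:: a] ++ [::]) ++ [:: b]) -!tensv_sket //.
  rewrite !tens_tensv !id_lfunE IH tensv_sumr tensv_suml castv_sum.
  apply: eq_big_seq => u /size_words um.
  rewrite tensvZr tensvZl castvZ !tensv_sket ?castv_vec //=.
    by rewrite -catA cats1.
  by rewrite size_cat size_rc um.
rewrite capE linearB linearZ /= castvD castvZ -scaleN1r castvZ !arc.
rewrite big_cat !big_map !scaler_sumr; congr (_ + _); apply: eq_bigr => u _.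
  rewrite rc_cons scalerA; congr (_ *: sket K _ _).
  by rewrite /cap_coef /ones /zeros /= add0n add1n exprS invfM mulrA.
rewrite rc_cons scalerA; congr (_ *: sket K _ _).
by rewrite /cap_coef /ones /zeros /= add0n add1n exprS mulrCA.
Qed.

End Caps.

(** Identifies the exponent of q in [Gamma1] as [inv10]: with N the length, the j-th nu_1, at
    position i_j, precedes (N - i_j) - (n - j) letters nu_0; sum over j. *)
Lemma sum_positions s : let n := ones s in
  (inv10 s + ((n ^ 2 - n)./2 + \sum_(j < size s | nth false s j) j.+1)
   = n * size s)%N.
Proof.
elim/last_ind: s => [|s a IH] /=; first by rewrite big_ord0.
rewrite size_rcons big_mkcond big_ord_recr /= nth_rcons ltnn eqxx.
under eq_bigr => j _ do rewrite nth_rcons ltn_ord.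
rewrite -big_mkcond /= inv10_rcons ones_rcons.
move: IH; rewrite /=; set n := ones s; set S := (\sum_(_ < _ | _) _)%N.
case: a => /= IH; last by rewrite muln1 !addn0; move: IH; nia.
rewrite muln0 addn0 addn1.
have -> : (n.+1 ^ 2 - n.+1 = n.*2 + (n ^ 2 - n))%N.
  by rewrite !expnS expn0; nia.
rewrite halfD odd_double doubleK; move: IH; nia.
Qed.

(** * The diagram and the composite on basis tensors *)

Section Composite.
Variables (K : fieldType) (q : K).

Lemma Gamma1_ket i (w : i.-1.-tuple bool) :
  Gamma1 q i (ket K w) =
  (q ^+ inv10 w * (qfact q (zeros w) / qfact q i.-1)) *: oket K i (ones w).
Proof.
rewrite lext_ket /= -/(ones w).
have zw : zeros w = (i.-1 - ones w)%N by rewrite zerosE size_tuple.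
rewrite zw; congr ((_ * _) *: _).
have := sum_positions w; rewrite /= size_tuple => E.
rewrite (_ : (\sum_(j < i.-1 | tnth w j) j.+1)%N
             = (\sum_(j < i.-1 | nth false w j) j.+1)%N); last first.
  by apply: eq_bigl => j; rewrite (tnth_nth false).
rewrite -E exprnP; congr (q ^ _).
by move: (_./2) (\sum_(_ < _ | _) _)%N => b c; rewrite !PoszD; ring.
Qed.

(** As (i-1) + (p-i) = p-1, the projection acts exactly on [w ++ u], while [rc u] passes along the
    last p - i strands. *)
Lemma diagram_ket p i (hi : (0 < i < p)%N) (w : i.-1.-tuple bool) :
  q != 0 -> (forall j, (0 < j < p)%N -> qint q j != 0) ->
  diagram q hi (ket K w) = \sum_(u <- words (p - i))
    (cap_coef q u * JW_coef q (w ++ u)) *: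
    vec (2 * p - i - 1) (fun s =>
      (ones (take p.-1 s) == ones w + ones u)%:R * q ^- inv01 (take p.-1 s)
      * (drop p.-1 s == rc u)%:R).
Proof.
move=> q0 nz; rewrite /diagram comp_lfunE !casthE ketE castv_vec -/(sket K _ w).
have -> : sket K (i.-1 + 0) w = tensv (sket K i.-1 w) (sket K 0 [::]).
  by rewrite tensv_sket ?size_tuple // cats0.
rewrite tens_tensv id_lfunE ncapE tensv_sumr !castv_sum linear_sum castv_sum.
apply: eq_big_seq => u /size_words um.
rewrite tensvZr !castvZ linearZ /= castvZ -scalerA; congr (_ *: _).
have wu : size (w ++ u) = p.-1 by rewrite size_cat size_tuple um; lia.
rewrite tensv_sket ?size_tuple // castv_vec castv_vec catA -/(sket _ _ _).
rewrite -tensv_sket // tens_tensv id_lfunE JW_sket // => [|j jp]; last first.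
  by apply: nz; lia.
by rewrite tensvZl castvZ /qsym /sket tensv_vec castv_vec ones_cat.
Qed.

(** Compares the coefficients of the word [x ++ rc u]; on the right stand the constant, the
    coefficient from [Gamma1], the factorial from the power of F and the coefficient in S. The
    factorials cancel by [qfact_sym], leaving powers of q and a sign. *)
Lemma diagram_coef p i (w u x : seq bool) :
  q != 0 -> q ^+ p = -1 -> (forall j, (0 < j < p)%N -> qint q j != 0) ->
  (0 < i < p)%N -> size w = i.-1 -> size u = (p - i)%N -> size x = p.-1 ->
  ones x = (ones w + ones u)%N ->
  cap_coef q u * JW_coef q (w ++ u) * q ^- inv01 x =
  qfact q i.-1 / qfact q p.-1 * q ^- (p - i)
  * (q ^+ inv10 w * (qfact q (zeros w) / qfact q i.-1))
  * qfact q (ones w + (p - i)) * q ^- inv01 (x ++ rc u).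
Proof.
move=> q0 qp nz hi sw su sx ox.
have [ow ou oX] := And3 (ones_zeros w) (ones_zeros u) (ones_zeros x).
have fn0 n : (n < p)%N -> qfact q n != 0.
  by move=> np; apply: (qfact_neq0 q0) => j jn; apply: nz; lia.
have fi : qfact q i.-1 != 0 by apply: fn0; lia.
have fp : qfact q p.-1 != 0 by apply: fn0; lia.
rewrite /JW_coef size_cat sw su ones_cat zeros_cat.
rewrite (_ : i.-1 + (p - i) = p.-1)%N; last by lia.
rewrite (qfact_sym q0 qp); last by lia.
rewrite divff // mulr1.
(* Here [zeros w]! [|w|+p-i]! = [p-1]!, the two arguments adding up to p - 1. *)
have -> : qfact q i.-1 / qfact q p.-1 * q ^- (p - i)
  * (q ^+ inv10 w * (qfact q (zeros w) / qfact q i.-1))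
  * qfact q (ones w + (p - i)) = q ^+ inv10 w / q ^+ (p - i).
  have <- := @qfact_sym _ _ _ q0 qp (zeros w) (ones w + (p - i)); last by lia.
  have : qfact q (zeros w) != 0 by apply: fn0; lia.
  have : qfact q (ones w + (p - i)) != 0 by apply: fn0; lia.
  move: (expf_neq0 (p - i) q0) fi.
  move: (q ^+ (p - i)) (qfact q i.-1) (qfact q (ones w + _)) (qfact q (zeros w)).
  move=> a b c d a0 b0 c0 d0; field; by rewrite a0 b0 c0 d0.
rewrite inv01_cat inv10_cat inv01_rc ones_rc /cap_coef -su -ou.
have e := inv01_inv10 u.
(* The sign of the caps is turned into a power of q. *)
have sgn : (-1) ^+ zeros u * q ^+ (p * zeros u) = 1 :> K.
  by rewrite exprM qp -exprMn mulrNN mulr1 expr1n.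
have {}sgn : (-1) ^+ zeros u * (q ^+ (inv10 u + ones w * zeros u)
    * q ^+ (inv01 u + zeros x * zeros u) * q ^+ zeros u) = 1.
  rewrite -[RHS]sgn -!exprD; congr (_ * q ^+ _).
  (* [x] has length p - 1 and |w| + |u| letters nu_1; the product [ones u * zeros u] then splits
     into [inv01 u + inv10 u]. *)
  have -> : (p = (ones u + ones w + zeros x).+1)%N by lia.
  by rewrite mulSn !mulnDl -e; lia.
rewrite -[RHS]mulr1 -[X in _ = _ * X]sgn -!addnA !exprD.
by field; rewrite !expf_neq0.
Qed.

End Composite.

Theorem proposition4p2 (R : realType) (K : fieldType) (p i : nat) (q : K)
    (hp : (2 <= p)%N) (hq : is_exp_ipi_over R p q) (hi : (0 < i < p)%N)
    (iota : 'Hom(Pproj K p i, tpow K (2 * p - i - 1)))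
    (hiota : is_Gamma3 q iota) :
  exists2 c : K, c != 0 &
    diagram q hi = c *: (iota \o Gamma2 K p i \o Gamma1 q i)%VF.
Proof.
have [q0 qp nz] := exp_ipi_over_root hp hq.
have nz1 : qint q 1 != 0 by apply: nz; lia.
have fn0 n : (n < p)%N -> qfact q n != 0.
  by move=> np; apply: (qfact_neq0 q0) => j jn; apply: nz; lia.
(* The quotient offsets the [i-1]! of [Gamma1] and the product [p-1]! of factorials; the power of q
   is what the caps leave, one q^-1 per arc, once the sign is rewritten by q^p = -1. *)
exists (qfact q i.-1 / qfact q p.-1 * q ^- (p - i)).
  by rewrite !mulf_neq0 ?invr_neq0 ?expf_neq0 ?fn0 //; lia.
apply: hom_ket_ext => w; rewrite diagram_ket // scale_lfunE !comp_lfunE Gamma1_ket.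
have sw := size_tuple w; have := ones_zeros w; rewrite sw => ow.
have wi : (ones w < i)%N by lia.
rewrite linearZ /= [oket K i (ones w)]/oket (insubT (fun k => k < i)%N wi) /=.
rewrite linearZ /= lext_ket /=.
have /= -> := hiota.2 (Ordinal wi); rewrite iter_uqF // !scalerA /qsym vecZ.
under eq_bigr do rewrite vecZ.
rewrite vec_sum; apply: eq_vec => s ss /=.
set x := take p.-1 s; set v := drop p.-1 s.
have sx : size x = p.-1 by rewrite size_takel // ss; lia.
have sv : size v = (p - i)%N by rewrite size_drop ss; lia.
have xv : s = x ++ v by rewrite cat_take_drop.
(* Both sides become sums over u, compared term by term; only the u with [rc u] equal to [v]
   contributes. *)
rewrite -[RHS]mulr1 -[X in _ = _ * X](sum_words_rc K sv) mulr_sumr.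
apply: eq_big_seq => u /size_words su.
have [vu|_] := eqVneq v (rc u); last by rewrite !mulr0.
rewrite !mulr1 xv vu ones_cat ones_rc.
have := ones_zeros u; rewrite su => ou.
(* The supports agree because [zeros u] is p - i - |u|. *)
rewrite (_ : (ones x + zeros u == ones w + (p - i))%N
           = (ones x == ones w + ones u)%N); last by apply/eqP/eqP; lia.
case: eqP => [ox|_]; last by rewrite !mul0r !mulr0.
by rewrite !mul1r (diagram_coef q0 qp nz hi sw su sx ox).
Qed.
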